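(* On each of the six finite domains $\mathcal P(5,3)$, $\mathcal P(6,3)$, $\mathcal P(4,4)$, $\mathcal P^{\mathrm{f}}(5,3)$, $\mathcal P^{\mathrm{f}}(6,3)$, $\mathcal P^{\mathrm{f}}(4,4)$ of target pairs, a pair $(H_w,H_r)$ is realizable if and only if it satisfies dominance and, for all $0\le m\le b_r$, the two bounds (LR) $\bar H_w(n-1+m)\ge\frac{n-1}{n}H_w(n)+H_r(m)$ at every $w$-vertex $n$ with $h_n>\rho_1$; (PC) $\bar H_w(m+1)\ge H_r(m)+\min\left\{\frac{H_w(n)}{n},\frac{H_w(n)-\rho_1}{n-1}\right\}$ at every $w$-vertex $n\ge3$ with $\bar H_r(2)<H_w(n)-(n-2)H_w(1)$.
   Context: Instances and realizability. An instance consists of a finite set $E$ of items with rational values $a_i\ge 0$, positive integer sizes $d_i$, and integer capacities $0\le R<D$, with $d_i\le D$ for every item. Write $G(S)=\sum_{i\in S}a_i$ and $d(S)=\sum_{i\in S}d_i$. For $\alpha\in\{w,r\}$ let $U^\alpha(n)$ be the maximum of $G(S)$ over $n$-element sets $S\subseteq E$ with $d(S)\le D$ (for $\alpha=w$) or $d(S)\le R$ (for $\alpha=r$), with value $-\infty$ if there is none; $U^\alpha(0)=0$. The terminal count is $b_\alpha=\min\operatorname{arg\,max}_n U^\alpha(n)$. The hull is the sequence on $\{0,\dots,b_\alpha\}$ obtained by evaluating at integers the upper concave hull of the points $(n,U^\alpha(n))$, $0\le n\le b_\alpha$. A target pair $(H_w,H_r)$ consists of strictly increasing concave rational sequences $H_\alpha$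 on $\{0,\dots,b_\alpha\}$ with $H_\alpha(0)=0$ (the zero sequence $(0)$, with $b_\alpha=0$, is allowed). It is realizable if a single instance has terminal counts $b_w,b_r$ and hulls exactly $H_w$ and $H_r$. There is no cardinality cap. Notation. $h_n=H_w(n)-H_w(n-1)$, $\rho_m=H_r(m)-H_r(m-1)$, $\rho_1:=0$ if $b_r=0$; $\bar H_\alpha(k)=H_\alpha(\min\{k,b_\alpha\})$. A positive count $n\le b_\alpha$ is an $\alpha$-vertex if $n=b_\alpha$ or the slopes of $H_\alpha$ immediately before and after $n$ differ. Dominance means $H_r(k)\le\bar H_w(k)$ for $0\le k\le b_r$. Domains. $\mathcal P(B,M)$ is the set of target pairs with $b_w=3$, $0\le b_r\le M$, all slopes $h_n,\rho_m$ (nonincreasing) positive integers at most $B$, and satisfying dominance. $\mathcal P^{\mathrm f}(B,M)$ is the set of pairs in $\mathcal P(B,M)$ with $b_r\ge1$ such that: at each $w$-vertex $n$ with $H_w(n)>(n-1)H_w(1)+\rho_1$ one has $\bar H_w(n-1+m)\ge\frac{n-1}{n}H_w(n)+H_r(m)$ for $0\le m\le b_r$; and, if $H_w$ is linear with $H_w(1)=\rho_1$ and $\bar H_r(2)<2\rho_1$, then $H_r(b_r)\le2\rho_1$. *)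

(* Defs.v *)
From mathcomp Require Import all_boot all_order all_algebra.
From mathcomp Require Import constructive_ereal.

Set Implicit Arguments.
Unset Strict Implicit.
Unset Printing Implicit Defensive.

Import Order.TTheory GRing.Theory Num.Theory.

Local Open Scope ring_scope.

Inductive side := w | r.

Record instance := Instance {
  item : finType;
  val_of : item -> rat;
  size_of : item -> nat;
  capR : nat;
  capD : nat;
  val_of_ge0 : forall i, 0 <= val_of i;
  size_of_gt0 : forall i, (0 < size_of i)%N;
  capRD : (capR < capD)%N;
  size_of_le : forall i, (size_of i <= capD)%N
}.

Definition cap (I : instance) (s : side) : nat :=
  match s with w => capD I | r => capR I end.

Definition gain (I : instance) (S : {set item I}) : rat :=
  \sum_(i in S) val_of i.

Definition dsize (I : instance) (S : {set item I}) : nat :=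
  (\sum_(i in S) size_of i)%N.

(* For [n = 0] only the empty set qualifies, so [U I s 0 = 0]. *)
Definition U (I : instance) (s : side) (n : nat) : \bar rat :=
  \big[Order.max/-oo%E]_(S : {set item I} | (#|S| == n) && (dsize S <= cap I s)%N)
     ((gain S)%:E)%E.

Definition argmax (u : nat -> \bar rat) (n : nat) : Prop :=
  forall k, (u k <= u n)%E.

Definition terminal_count (u : nat -> \bar rat) (b : nat) : Prop :=
  argmax u b /\ forall n, argmax u n -> (b <= n)%N.

(* [y] is the height above [x] of some convex combination of the points
   [(n, u n)], [0 <= n <= b]; since [0 * -oo = 0] in [\bar rat], a point at
   height [-oo] contributes only when its weight is nonzero. *)
Definition comb_height (u : nat -> \bar rat) (b : nat) (x : rat) (y : \bar rat)
    : Prop :=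
  exists lam : 'I_b.+1 -> rat,
    [/\ forall n, 0 <= lam n,
        \sum_n lam n = 1,
        \sum_n lam n * (n : nat)%:R = x
      & (\sum_n (lam n)%:E * u n)%E = y].

(* The upper concave hull at [x] is the largest height above [x] in the convex
   hull of the points. *)
Definition hull_at (u : nat -> \bar rat) (b : nat) (x : rat) (y : \bar rat)
    : Prop :=
  comb_height u b x y /\ forall z, comb_height u b x z -> (z <= y)%E.

Definition is_hull (u : nat -> \bar rat) (b : nat) (h : b.+1.-tuple rat) : Prop :=
  forall k, (k <= b)%N -> hull_at u b k%:R (h`_k)%:E.

(* Meaningful for [1 <= n < size h]. *)
Definition slope (h : seq rat) (n : nat) : rat := h`_n - h`_n.-1.

Definition target_seq (b : nat) (h : b.+1.-tuple rat) : Prop :=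
  [/\ h`_0 = 0,
      forall n, (n < b)%N -> h`_n < h`_n.+1
    & forall n, (0 < n < b)%N -> slope h n.+1 <= slope h n].

Record target_pair := TargetPair {
  b : side -> nat;
  H : forall s, (b s).+1.-tuple rat;
  HP : forall s, target_seq (H s)
}.

Definition realizable (p : target_pair) : Prop :=
  exists I : instance, forall s,
    terminal_count (U I s) (b p s) /\ is_hull (U I s) (H p s).

Section Conditions.
Variable p : target_pair.

Definition Hbar (s : side) (k : nat) : rat := (H p s)`_(minn k (b p s)).

Definition rho1 : rat := if b p r == 0%N then 0 else slope (H p r) 1.

Definition vertex (s : side) (n : nat) : bool :=
  (0 < n <= b p s)%N &&
  ((n == b p s) || (slope (H p s) n != slope (H p s) n.+1)).

Definition dominance : Prop :=
  forall k, (k <= b p r)%N -> (H p r)`_k <= Hbar w k.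

Definition LR_ineq (n m : nat) : Prop :=
  n.-1%:R / n%:R * (H p w)`_n + (H p r)`_m <= Hbar w (n.-1 + m).

Definition LR (m : nat) : Prop :=
  forall n, vertex w n -> rho1 < slope (H p w) n -> LR_ineq n m.

Definition PC (m : nat) : Prop :=
  forall n, vertex w n -> (3 <= n)%N ->
    Hbar r 2 < (H p w)`_n - n.-2%:R * (H p w)`_1 ->
    (H p r)`_m + Num.min ((H p w)`_n / n%:R) (((H p w)`_n - rho1) / n.-1%:R)
      <= Hbar w m.+1.

Definition linear_w : Prop :=
  forall n, (n <= b p w)%N -> (H p w)`_n = n%:R * (H p w)`_1.

End Conditions.

(* Slopes are nonincreasing by concavity of the target sequences. *)
Definition domP (B M : nat) (p : target_pair) : Prop :=
  [/\ b p w = 3%N,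
      (b p r <= M)%N,
      forall s n, (0 < n <= b p s)%N ->
        exists2 k : nat, (0 < k <= B)%N & slope (H p s) n = k%:R
    & dominance p].

Definition domPf (B M : nat) (p : target_pair) : Prop :=
  [/\ domP B M p,
      (1 <= b p r)%N,
      forall n, vertex p w n ->
        n.-1%:R * (H p w)`_1 + rho1 p < (H p w)`_n ->
        forall m, (m <= b p r)%N -> LR_ineq p n m
    & linear_w p -> (H p w)`_1 = rho1 p -> Hbar p r 2 < 2 * rho1 p ->
        (H p r)`_(b p r) <= 2 * rho1 p].

(* Main.v *)
Require Import Defs.
From mathcomp Require Import all_boot all_order all_algebra.
From mathcomp Require Import constructive_ereal zify ring lra.

(** Extend a target hull [H p s] to all counts by the constant [H_b]; the
    extension [Hbar p s] is nondecreasing and concave, and its corners are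
    exactly the vertices of the hull.  An instance realizes the pair if and only
    if, for both capacities, no feasible set [S] beats the extension at [#|S|],
    and every corner is attained by a feasible set ([realizableP], through
    [fits]).  The upper concave hull thereby disappears from the problem.

    The two bounds are necessary for every pair, not just for those of the
    finite domains.  In both cases one exchanges items between a set [S]
    attaining the w-corner [n] and a set [T] attaining an r-corner [m]; the
    bound for other values of [m] follows because [Hbar p r] is affine between
    its corners and [Hbar p w] is concave ([tips_suffice]).
    - If [h_n > rho_1], an item of [S] of size at most [R] would have value at
      most [rho_1], yet removing it would lose at least [h_n].  So all items of
      [S] are larger than [R]: the cheapest of them can be exchanged for the
      whole of [T] ([LR_necessary]).
    - If [Hbar_r(2) < H_w(n) - (n-2) H_w(1)], two items of [S] are worth too much
      to fit together under [R], so any two of them have total size more than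
      [R].  When [n >= 3], this leaves room for any item of [S] next to [T], and
      [S] meets [T] in at most one item, which is worth at most [rho_1]
      ([PC_necessary]).

    Conversely, the values of an instance may be read off the target pair once
    its sizes and capacities have been chosen.  A list of 23 such templates
    contains, for every admissible pair of the domains, one that realizes it.
    The other four domains lie in P(6,3) or P(4,4), and those two are checked
    by computation with a verified decision procedure on lists of items
    ([fits_list]). *)

Set Implicit Arguments.
Unset Strict Implicit.
Unset Printing Implicit Defensive.

Import Order.TTheory GRing.Theory Num.Theory.

Local Open Scope ring_scope.

(** * Concave sequences *)

Definition step (f : nat -> rat) (k : nat) : rat := f k.+1 - f k.

Definition concave (f : nat -> rat) : Prop :=
  forall k, step f k.+1 <= step f k.

Definition corner (f : nat -> rat) (n : nat) : bool :=
  if n is k.+1 then step f k.+1 < step f k else false.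

(** The points between which a concave sequence that is constant from some
    corner on is affine. *)
Definition tip (f : nat -> rat) (n : nat) : bool := (n == 0%N) || corner f n.

Section Concave.
Variable f : nat -> rat.
Hypothesis cf : concave f.

Lemma step_anti i j : (i <= j)%N -> step f j <= step f i.
Proof.
move=> /subnK <-; elim: (j - i)%N => [|d IHd] //.
by rewrite addSn; apply: le_trans (cf _) IHd.
Qed.

Lemma tangent k j : f j <= f k + (j%:R - k%:R) * step f k.
Proof.
case: (leqP k j) => [/subnKC <-|/ltnW /subnKC <-].
  elim: (j - k)%N => [|d IHd]; first by rewrite addn0 subrr mul0r addr0.
  have le_s := step_anti (leq_addr d k).
  have Ed : f (k + d).+1 = f (k + d)%N + step f (k + d) by rewrite /step; ring.
  by rewrite addnS Ed -natr1 !natrD in IHd *; lra.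
elim: (k - j)%N => [|d IHd]; first by rewrite addn0 subrr mul0r addr0.
have le_s := cf (j + d).
have : d%:R * step f (j + d).+1 <= d%:R * step f (j + d).
  by apply: ler_wpM2l.
have Ed : f (j + d).+1 = f (j + d)%N + step f (j + d) by rewrite /step; ring.
rewrite addnS -[(j + d).+1%:R]natr1 natrD Ed in IHd *; lra.
Qed.

(** Any slope strictly between those before and after the corner will do; the
    proof takes their mean. *)
Lemma strict_tangent n : corner f n ->
  exists s, forall j, j != n -> f j < f n + (j%:R - n%:R) * s.
Proof.
case: n => // k /= lt_s; exists ((step f k + step f k.+1) / 2) => j.
case: ltngtP => // lt_jk _.
  apply: le_lt_trans (tangent k j) _.
  have: (0 : rat) < (k.+1)%:R - j%:R by rewrite subr_gt0 ltr_nat.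
  have -> : f k.+1 = f k + step f k by rewrite /step; ring.
  move: lt_s; rewrite -natr1; nra.
apply: le_lt_trans (tangent k.+1 j) _.
have: (0 : rat) < j%:R - (k.+1)%:R by rewrite subr_gt0 ltr_nat.
by rewrite -subr_gt0 in lt_s; nra.
Qed.

Lemma not_tip k : ~~ tip f k.+1 -> step f k.+1 = step f k.
Proof. by rewrite /tip /= -leNgt => le_s; apply/le_anti; rewrite cf le_s. Qed.

Lemma tip_before k : exists l,
  [/\ (l <= k)%N, tip f l & f k.+1 = f l + (k.+1%:R - l%:R) * step f k].
Proof.
elim: k => [|k [l [le_lk tl El]]].
  by exists 0%N; split=> //; rewrite /step; ring.
have [tk|/not_tip sk] := boolP (tip f k.+1).
  by exists k.+1; split=> //; rewrite /step -[k.+2%:R]natr1; ring.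
exists l; split=> //; first exact: leqW.
have -> : f k.+2 = f k.+1 + step f k.+1 by rewrite /step; ring.
by rewrite sk El -[k.+2%:R]natr1; ring.
Qed.

Lemma tip_after b k : tip f b -> (k < b)%N -> exists u,
  [/\ (k < u <= b)%N, tip f u & f u = f k + (u%:R - k%:R) * step f k].
Proof.
move=> tb; have [d] := ubnP (b - k); elim: d k => // d IHd k ltd lt_kb.
have Ek : f k.+1 = f k + step f k by rewrite /step; ring.
have [tk|ntk] := boolP (tip f k.+1).
  by exists k.+1; rewrite leqnn lt_kb Ek -natr1; split=> //; ring.
have lt_k1b : (k.+1 < b)%N.
  by rewrite ltn_neqAle lt_kb andbT; apply: contraNneq ntk => ->.
have [|u [/andP[lt_ku le_ub] tu Eu]] := IHd k.+1 _ lt_k1b; first lia.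
exists u; rewrite (ltnW lt_ku) le_ub; split=> //.
by rewrite Eu (not_tip ntk) Ek -natr1; ring.
Qed.

(** A sequence is affine on the interval between two consecutive tips. *)
Lemma between_tips b k : tip f b -> (k <= b)%N -> exists l u t,
  [/\ tip f l /\ tip f u, (l <= b /\ u <= b)%N, 0 <= t <= 1,
      (1 - t) * l%:R + t * u%:R = k%:R & f k = (1 - t) * f l + t * f u].
Proof.
move=> tb; rewrite leq_eqVlt => le_kb.
have [tk|] := boolP (tip f k).
  have le_k : (k <= b)%N by case/orP: le_kb => [/eqP->//|/ltnW].
  by exists k, k, 0; split=> //; ring.
case: k le_kb => // k /orP[/eqP->|lt_kb]; first by rewrite tb.
move/not_tip => sk.
have [l [le_lk tl El]] := tip_before k.
have [u [/andP[lt_ku le_ub] tu Eu]] := tip_after tb lt_kb.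
have lt_lk : (l%:R : rat) < k.+1%:R by rewrite ltr_nat.
have lt_ku' : (k.+1%:R : rat) < u%:R by rewrite ltr_nat.
have lu0 : (u%:R - l%:R : rat) != 0 by rewrite subr_eq0 gt_eqF //; lra.
exists l, u, ((k.+1%:R - l%:R) / (u%:R - l%:R)); split=> //.
- by split; lia.
- rewrite ler_pdivrMr ?ler_pdivlMr; lra.
- by field.
- rewrite Eu sk El; field.
  by rewrite lu0.
Qed.

End Concave.

(** * Realizability without hulls *)

Section Extension.
Variables (p : target_pair) (s : side).
Local Notation h := (H p s).
Local Notation b := (b p s).
Local Notation f := (Hbar p s).

Lemma Hbar_le k : (k <= b)%N -> f k = h`_k.
Proof. by rewrite /Hbar => /minn_idPl->. Qed.

Lemma Hbar_ge k : (b <= k)%N -> f k = h`_b.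
Proof. by rewrite /Hbar => /minn_idPr->. Qed.

Lemma Hbar0 : f 0 = 0.
Proof. by rewrite Hbar_le //; case: (HP p s). Qed.

Lemma step_Hbar k : (k < b)%N -> step f k = slope h k.+1.
Proof. by move=> ltkb; rewrite /step /slope !Hbar_le // ltnW. Qed.

Lemma step_Hbar_gt0 k : (k < b)%N -> 0 < step f k.
Proof.
by move=> ltkb; rewrite step_Hbar // subr_gt0; case: (HP p s) => _ -> .
Qed.

Lemma step_Hbar0 k : (b <= k)%N -> step f k = 0.
Proof. by move=> lebk; rewrite /step !Hbar_ge ?subrr // leqW. Qed.

Lemma step_Hbar_ge0 k : 0 <= step f k.
Proof. by case: (ltnP k b) => [/step_Hbar_gt0/ltW|/step_Hbar0->]. Qed.

Lemma Hbar_concave : concave f.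
Proof.
move=> k; case: (ltnP k.+1 b) => [lt_kb|/step_Hbar0->]; last exact: step_Hbar_ge0.
by rewrite !step_Hbar ?(ltnW lt_kb) //; case: (HP p s) => _ _; apply.
Qed.

Lemma Hbar_homo i j : (i <= j)%N -> f i <= f j.
Proof.
move=> /subnK <-; elim: (j - i)%N => [|d IHd] //.
by rewrite addSn; apply: le_trans IHd _; rewrite -subr_ge0 step_Hbar_ge0.
Qed.

Lemma Hbar_le_end k : f k <= f b.
Proof.
by case: (leqP k b) => [/Hbar_homo //|/ltnW lebk]; rewrite !Hbar_ge.
Qed.

Lemma Hbar_lt_end k : (k < b)%N -> f k < f b.
Proof.
move=> ltkb; apply: lt_le_trans (Hbar_homo ltkb).
by rewrite -subr_gt0 step_Hbar_gt0.
Qed.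

(** The slopes before [b] are positive and those after it vanish, so the end
    point [b] is a corner like any other vertex. *)
Lemma vertexE n : vertex p s n = corner f n.
Proof.
rewrite /vertex; case: n => // k /=; case: (ltngtP k.+1 b) => [lt_kb|gt_kb|eq_kb] /=.
- rewrite !step_Hbar ?(ltnW lt_kb) // lt_neqAle eq_sym; symmetry.
  by apply/andb_idr => _; case: (HP p s) => _ _; apply.
- by rewrite !step_Hbar0 ?ltxx // ltnW.
- by rewrite (@step_Hbar0 k.+1) ?step_Hbar_gt0 -?eq_kb.
Qed.

Lemma corner_le n : corner f n -> (n <= b)%N.
Proof. by rewrite -vertexE => /andP[/andP[]]. Qed.

Lemma tip_end : tip f b.
Proof. by rewrite /tip -vertexE /vertex eqxx leqnn lt0n !andbT orbN. Qed.

End Extension.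

(** What realizability amounts to on one side, free of maxima and hulls. *)
Definition fits (I : instance) (s : side) (f : nat -> rat) : Prop :=
  (forall S : {set item I}, (dsize S <= cap I s)%N -> gain S <= f #|S|) /\
  (forall n, corner f n -> exists S : {set item I},
     [/\ #|S| = n, (dsize S <= cap I s)%N & gain S = f n]).

Section Hull.
Variables (I : instance) (s : side).
Local Notation u := (U I s).

Lemma gain_le_U (S : {set item I}) :
  (dsize S <= cap I s)%N -> ((gain S)%:E <= u #|S|)%E.
Proof.
move=> fS; rewrite /U.
by apply: (@le_bigmax_cond _ _ _ _ S _ (fun S => (gain S)%:E)); rewrite eqxx.
Qed.

Lemma U_le n (y : rat) :
  (forall S : {set item I}, #|S| = n -> (dsize S <= cap I s)%N -> gain S <= y) ->
  (u n <= y%:E)%E.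
Proof.
move=> ub; rewrite /U; apply: bigmax_le; first exact: leNye.
by move=> S /andP[/eqP nS fS]; rewrite lee_fin ub.
Qed.

Lemma U_attained n (y : rat) : u n = y%:E ->
  exists S : {set item I}, [/\ #|S| = n, (dsize S <= cap I s)%N & gain S = y].
Proof.
rewrite /U; elim/big_rec: _ => // S z /andP[/eqP nS fS] IHz.
rewrite /Order.max; case: ifP => // _ [gS]; by exists S.
Qed.

Lemma U0 : u 0%N = 0%E.
Proof.
have g0 (S : {set item I}) : #|S| = 0%N -> gain S = 0.
  by move/cards0_eq->; rewrite /gain big_set0.
apply/le_anti; rewrite U_le => [|S /g0->//] /=.
have := @gain_le_U set0; rewrite g0 ?cards0 // => -> //.
by rewrite /dsize big_set0.
Qed.

(** Averaging an affine function [c + (n - x) * d] with weights of barycentre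
    [x] gives [c]. *)
Lemma comb_height_le b (f : nat -> rat) x y c d : 
  (forall n, (n <= b)%N -> (u n <= (f n)%:E)%E) ->
  (forall n, (n <= b)%N -> f n <= c + (n%:R - x) * d) ->
  comb_height u b x y -> (y <= c%:E)%E.
Proof.
move=> le_uf le_fc [lam [lam0 lam1 lamx <-]].
have -> : c = \sum_n lam n * (c + (n%:R - x) * d).
  under eq_bigr => n _ do rewrite mulrDr mulrA mulrBr.
  rewrite big_split /= -!mulr_suml sumrB lamx -mulr_suml lam1; ring.
rewrite -sumEFin; apply: lee_sum => n _.
have len : (n <= b)%N by rewrite -ltnS.
apply: le_trans (lee_wpmul2l _ (le_uf n len)) _; first by rewrite lee_fin.
by rewrite -EFinM lee_fin ler_wpM2l ?le_fc.
Qed.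

Lemma comb_height_delta b n : (n <= b)%N -> comb_height u b n%:R (u n).
Proof.
move=> len; exists (fun i => (i == inord n)%:R); split.
- by move=> i; rewrite ler0n.
- by rewrite (bigD1 (inord n)) //= eqxx big1 ?addr0 // => i /negPf->.
- rewrite (bigD1 (inord n)) //= eqxx mul1r big1 ?addr0 ?inordK // => i /negPf->.
  by rewrite mul0r.
- rewrite (bigD1 (inord n)) //= eqxx mul1e big1 ?adde0 ?inordK // => i /negPf->.
  by rewrite mul0e.
Qed.

End Hull.

Section Realization.
Variables (p : target_pair) (I : instance) (s : side).
Local Notation f := (Hbar p s).
Local Notation b := (b p s).
Local Notation u := (U I s).

(** At a tip [U] equals the extension, and every other point of the hull is a
    convex combination of two tips; no combination lies above a tangent. *)
Lemma fits_realizes :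
  fits I s f -> terminal_count u b /\ is_hull u (H p s).
Proof.
case=> ub at_corner.
have le_uf n : (u n <= (f n)%:E)%E by apply: U_le => S <-; apply: ub.
have u_tip n : tip f n -> u n = (f n)%:E.
  case/orP=> [/eqP->|/at_corner[S [nS fS gS]]]; first by rewrite U0 Hbar0.
  by apply/le_anti; rewrite le_uf -gS -nS gain_le_U.
have le_ub n : (u n <= u b)%E.
  by rewrite (u_tip b) ?tip_end // (le_trans (le_uf n)) ?lee_fin ?Hbar_le_end.
split.
  split=> // n max_n; rewrite leqNgt; apply/negP => lt_nb.
  have := le_trans (max_n b) (le_uf n).
  by rewrite u_tip ?tip_end // lee_fin leNgt Hbar_lt_end.
move=> k le_kb; rewrite -Hbar_le //; split=> [|z]; last first.
  apply: (@comb_height_le _ _ _ f _ _ _ (step f k)) => // n _.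
  exact/tangent/Hbar_concave.
have [l [r [t [[tl tr] [le_lb le_rb] /andP[t0 t1] Ek Efk]]]] :=
  between_tips (@Hbar_concave p s) (@tip_end p s) le_kb.
pose lam (i : 'I_b.+1) : rat := (1 - t) * (i == inord l)%:R + t * (i == inord r)%:R.
have sum_lam g : \sum_i lam i * g (i : nat) = (1 - t) * g l + t * g r.
  under eq_bigr => i _ do rewrite mulrDl.
  rewrite big_split /= (bigD1 (inord l)) //= big1 ?addr0 => [|i /negPf->].
    rewrite (bigD1 (inord r)) //= big1 ?addr0 => [|i /negPf->].
      by rewrite !eqxx !inordK // !mulr1.
    by rewrite mulr0 mul0r.
  by rewrite mulr0 mul0r.
exists lam; split.
- by move=> i; rewrite addr_ge0 // mulr_ge0 ?ler0n // subr_ge0.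
- under eq_bigr => i _ do rewrite -[lam i]mulr1.
  by rewrite (sum_lam (fun=> 1)); ring.
- by rewrite (sum_lam (fun i => i%:R)).
- rewrite Efk -sum_lam -sumEFin; apply: eq_bigr => i _.
  have [->|nl] := eqVneq i (inord l); first by rewrite inordK // u_tip.
  have [->|nr] := eqVneq i (inord r); first by rewrite inordK // u_tip.
  by rewrite /lam (negPf nl) (negPf nr) !mulr0 addr0 mul0e mul0r.
Qed.

(** If [U] missed the hull at a corner [n], it would lie strictly below a
    strict tangent at [n] everywhere, and no convex combination of its points
    could reach the hull above [n]. *)
Lemma realizes_fits :
  terminal_count u b -> is_hull u (H p s) -> fits I s f.
Proof.
move=> [max_b _] hull_u.
have le_uf n : (u n <= (f n)%:E)%E.
  have le_n m : (m <= b)%N -> (u m <= (f m)%:E)%E.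
    by move=> le_mb; rewrite Hbar_le //; apply/(hull_u m le_mb).2/comb_height_delta.
  case: (leqP n b) => [/le_n//|lt_bn].
  rewrite (le_trans (max_b n)) // (le_trans (le_n b _)) // lee_fin.
  exact/Hbar_homo/ltnW.
split=> [S fS|n cn]; first by rewrite -lee_fin (le_trans (gain_le_U fS)).
have le_nb := corner_le cn; apply: U_attained.
apply/le_anti; rewrite le_uf /= leNgt; apply/negP => lt_uf.
have [d lt_d] := strict_tangent (@Hbar_concave p s) cn.
pose L (j : nat) : rat := f n + (j%:R - n%:R) * d.
have lt_uL j : (u j < (L j)%:E)%E.
  have [->|nj] := eqVneq j n; first by rewrite /L subrr mul0r addr0.
  by rewrite (le_lt_trans (le_uf j)) // lte_fin lt_d.
(* Real heights between [U] and the tangent, to remove the values [-oo]. *)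
have {lt_uL} [v v_lt le_uv] : exists2 v : nat -> rat,
    (forall j, v j < L j) & (forall j, (u j <= (v j)%:E)%E).
  exists (fun j => if u j is y%:E%E then y else L j - 1) => j.
    by case: (u j) (lt_uL j) => //= _; rewrite ltrBlDr ltrDl.
  by case: (u j) (lt_uL j) => //= _; rewrite leNye.
have [[lam [lam0 lam1 lamn Elam]] _] := hull_u n le_nb.
rewrite -Hbar_le // in Elam.
have le_fv : f n <= \sum_j lam j * v j.
  rewrite -lee_fin -Elam -sumEFin; apply: lee_sum => j _.
  by rewrite EFinM lee_wpmul2l ?lee_fin.
have sumL : \sum_j lam j * L j = f n.
  under eq_bigr => j _ do rewrite /L mulrDr mulrA mulrBr.
  by rewrite big_split /= -!mulr_suml sumrB lamn -mulr_suml lam1; ring.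
have gap0 j : 0 <= lam j * (L j - v j) by rewrite mulr_ge0 // subr_ge0 ltW.
have : \sum_j lam j * (L j - v j) == 0.
  rewrite eq_le sumr_ge0 // andbT.
  under eq_bigr => j _ do rewrite mulrBr.
  by rewrite sumrB sumL subr_le0.
rewrite psumr_eq0 // => /allP lam_eq0.
have: \sum_j lam j == 0.
  rewrite big1 // => j _; apply/eqP.
  have := lam_eq0 j (mem_index_enum j).
  by rewrite /= mulf_eq0 subr_eq0 (gt_eqF (v_lt j)) orbF.
by rewrite lam1 oner_eq0.
Qed.

End Realization.

Lemma realizableP p :
  realizable p <-> exists I : instance, forall s, fits I s (Hbar p s).
Proof.
split=> [] [I rI]; exists I => s; last exact: fits_realizes.
by case: (rI s); apply: realizes_fits.
Qed.

(** * Necessity of the bounds *)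

Section Items.
Variable I : instance.
Implicit Types (S T : {set item I}) (i j : item I).

Lemma gainD1 S i : i \in S -> gain S = val_of i + gain (S :\ i).
Proof. by move=> iS; rewrite /gain (big_setD1 i). Qed.

Lemma gainU1 S i : i \notin S -> gain (i |: S) = val_of i + gain S.
Proof. by move=> iS; rewrite /gain big_setU1. Qed.

Lemma gain1 i : gain [set i] = val_of i.
Proof. by rewrite /gain big_set1. Qed.

Lemma gainU S T : [disjoint S & T] -> gain (S :|: T) = gain S + gain T.
Proof. by move=> dis; rewrite -bigU //; apply: eq_bigl => i; rewrite !inE. Qed.

Lemma dsizeD1 S i : i \in S -> dsize S = (size_of i + dsize (S :\ i))%N.
Proof. by move=> iS; rewrite /dsize (big_setD1 i). Qed.

Lemma dsizeU1 S i : i \notin S -> dsize (i |: S) = (size_of i + dsize S)%N.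
Proof. by move=> iS; rewrite /dsize big_setU1. Qed.

Lemma dsize1 i : dsize [set i] = size_of i.
Proof. by rewrite /dsize big_set1. Qed.

Lemma dsizeU S T : [disjoint S & T] -> dsize (S :|: T) = (dsize S + dsize T)%N.
Proof. by move=> dis; rewrite -bigU //; apply: eq_bigl => i; rewrite !inE. Qed.

Lemma size_of_dsize S i : i \in S -> (size_of i <= dsize S)%N.
Proof. by move=> /dsizeD1->; apply: leq_addr. Qed.

Lemma size_of2_dsize S i j : i \in S -> j \in S -> i != j ->
  (size_of i + size_of j <= dsize S)%N.
Proof.
move=> iS jS ij; rewrite (dsizeD1 iS) leq_add2l size_of_dsize //.
by rewrite !inE eq_sym ij.
Qed.

Lemma sum_const_set S (c : rat) : \sum_(i in S) c = #|S|%:R * c.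
Proof. by rewrite sumr_const mulr_natl. Qed.

Lemma item_le_mean S : (0 < #|S|)%N ->
  exists2 i, i \in S & #|S|%:R * val_of i <= gain S.
Proof.
case/card_gt0P=> i0 i0S.
case: (@arg_minP _ _ _ i0 [in S] (@val_of I) i0S) => i iS min_i.
by exists i => //; rewrite -sum_const_set; apply: ler_sum => j /min_i.
Qed.

Lemma item_ge_mean S : (0 < #|S|)%N ->
  exists2 i, i \in S & gain S <= #|S|%:R * val_of i.
Proof.
case/card_gt0P=> i0 i0S.
case: (@arg_maxP _ _ _ i0 [in S] (@val_of I) i0S) => i iS max_i.
by exists i => //; rewrite -sum_const_set; apply: ler_sum => j /max_i.
Qed.

Lemma fits_tip s f n : f 0%N = 0 -> fits I s f -> tip f n ->
  exists S, [/\ #|S| = n, (dsize S <= cap I s)%N & gain S = f n].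
Proof.
move=> f0 [_ at_corner] /orP[/eqP->|/at_corner //].
by exists set0; rewrite cards0 /dsize /gain !big_set0 f0.
Qed.

Lemma val_le_fits s f i :
  fits I s f -> (size_of i <= cap I s)%N -> val_of i <= f 1%N.
Proof. by case=> ub _; rewrite -gain1 -(cards1 i) -dsize1 => /ub. Qed.

End Items.

(** Between two tips the left-hand side is affine, while the right-hand side
    is concave. *)
Lemma tips_suffice p (g : nat -> rat) k c : concave g ->
  (forall m, tip (Hbar p r) m -> c + Hbar p r m <= g (k + m)%N) ->
  forall m, (m <= b p r)%N -> c + Hbar p r m <= g (k + m)%N.
Proof.
move=> cg at_tips m le_mb.
have [l [u [t [[tl tu] _ /andP[t0 t1] Em ->]]]] :=
  between_tips (@Hbar_concave p r) (@tip_end p r) le_mb.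
have Hl := le_trans (at_tips l tl) (tangent cg (k + m) (k + l)).
have Hu := le_trans (at_tips u tu) (tangent cg (k + m) (k + u)).
have {}Hl : (1 - t) * (c + Hbar p r l) <=
    (1 - t) * (g (k + m)%N + ((k + l)%:R - (k + m)%:R) * step g (k + m)).
  by rewrite ler_wpM2l // subr_ge0.
have {}Hu := ler_wpM2l t0 Hu.
have Edev : (1 - t) * ((k + l)%:R - (k + m)%:R) * step g (k + m) +
    t * ((k + u)%:R - (k + m)%:R) * step g (k + m) = 0.
  by rewrite -mulrDl !natrD -Em; ring.
lra.
Qed.

Section Necessity.
Variables (p : target_pair) (I : instance).
Hypotheses (fw : fits I w (Hbar p w)) (fr : fits I r (Hbar p r)).
Local Notation Hw := (Hbar p w).
Local Notation Hr := (Hbar p r).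

Lemma rho1E : rho1 p = Hr 1.
Proof.
rewrite /rho1; case: eqP => [b0|/eqP].
  by have := @step_Hbar0 p r 0; rewrite /step Hbar0 subr0 b0 => ->.
rewrite -lt0n => b_gt0.
by rewrite -step_Hbar // /step Hbar0 subr0.
Qed.

(** The cheapest item of an optimal [n]-set, whose items are all larger than
    [R], is exchanged for a set that is feasible for [R]. *)
Lemma LR_necessary n m : corner Hw n -> rho1 p < Hw n - Hw n.-1 ->
  (m <= b p r)%N -> n.-1%:R / n%:R * Hw n + Hr m <= Hw (n.-1 + m)%N.
Proof.
case: n => // n cn; rewrite rho1E /= => lt_rho; move: m.
apply: tips_suffice => [|m tm]; first exact: Hbar_concave.
have [S [nS fS gS]] := fw.2 _ cn.
have big_items i : i \in S -> (capR I < size_of i)%N.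
  move=> iS; rewrite ltnNge; apply/negP => /(val_le_fits fr) le_i.
  have := fw.1 (S :\ i); rewrite -(leq_add2l (size_of i)) -dsizeD1 //.
  move/(_ (leq_trans fS (leq_addl _ _))).
  move: (gainD1 iS); rewrite gS => E.
  have -> : #|S :\ i| = n by move: nS; rewrite (cardsD1 i) iS => -[].
  by move: E; move: lt_rho le_i; lra.
have [|i iS] := @item_le_mean I S; first by rewrite nS.
rewrite nS gS => le_i.
have [T [nT fT gT]] := fits_tip (Hbar0 p r) fr tm.
have disST : [disjoint S & T].
  rewrite -setI_eq0; apply/set0Pn => -[j /setIP[/big_items lt_j /size_of_dsize]].
  by move/leq_trans/(_ fT); rewrite leqNgt lt_j.
have disT : [disjoint S :\ i & T] by apply: disjointWl disST; apply: subD1set.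
have := fw.1 (S :\ i :|: T); rewrite gainU // dsizeU //.
have -> : #|(S :\ i) :|: T| = (n + m)%N.
  rewrite cardsU disjoint_setI0 // cards0 subn0 nT.
  by move: nS; rewrite (cardsD1 i) iS => -[<-].
have := big_items i iS; move: (dsizeD1 iS) fS fT => /= -> fS fT lt_i.
have -> : (dsize (S :\ i) + dsize T <= cap I w)%N by move: fS fT lt_i => /=; lia.
move=> /(_ isT); apply: le_trans; rewrite gT lerD2r.
have n1 : (n.+1%:R : rat) != 0 by rewrite pnatr_eq0.
have n0 : (0 : rat) < n.+1%:R by rewrite ltr0n.
have : val_of i <= Hw n.+1 / n.+1%:R by rewrite ler_pdivlMr // mulrC.
move: (gainD1 iS); rewrite gS => E.
have -> : n%:R / n.+1%:R * Hw n.+1 = Hw n.+1 - Hw n.+1 / n.+1%:R.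
  by rewrite -[n.+1%:R]natr1 in n1 *; field.
by move: E; set q := _ / _; lra.
Qed.

(** One item of an optimal [n]-set fits next to any set feasible for [R].  The
    first term of the minimum is the mean value of the [n]-set [S], for [T]
    disjoint from [S]; the second bounds the mean of what remains of [S] when
    it shares an item with [T]. *)
Lemma PC_necessary n m : corner Hw n -> (3 <= n)%N ->
  Hr 2 < Hw n - n.-2%:R * Hw 1 -> (m <= b p r)%N ->
  Hr m + Num.min (Hw n / n%:R) ((Hw n - rho1 p) / n.-1%:R) <= Hw m.+1.
Proof.
move=> cn n3 lt_pair; rewrite addrC -add1n; move: m.
apply: tips_suffice => [|m tm]; first exact: Hbar_concave.
have [S [nS fS gS]] := fw.2 _ cn.
(* The other [n - 2] items of [S] are worth at most [Hw 1] each. *)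
have big_pairs i j : i \in S -> j \in S -> i != j ->
    (capR I < size_of i + size_of j)%N.
  move=> iS jS ij; have jSi : j \in S :\ i by rewrite !inE eq_sym ij.
  rewrite ltnNge; apply/negP => le_R.
  have := fr.1 [set i; j].
  rewrite gainU1 ?dsizeU1 ?inE // gain1 dsize1 cards2 ij => /(_ le_R) le_ij.
  have : gain (S :\ i :\ j) <= n.-2%:R * Hw 1.
    have <- : #|S :\ i :\ j| = n.-2.
      by move: nS; rewrite (cardsD1 i) iS (cardsD1 j) jSi => <-.
    rewrite -sum_const_set; apply: ler_sum => k _.
    exact/(val_le_fits fw)/size_of_le.
  move: (gainD1 iS) (gainD1 jSi); rewrite gS.
  move: lt_pair le_ij; lra.
(* Two of the other items of [S] already take more than [R]. *)
have room i : i \in S -> (size_of i + capR I <= capD I)%N.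
  move=> iS.
  have : (1 < #|S :\ i|)%N by move: nS; rewrite (cardsD1 i) iS; lia.
  case/card_gt1P=> j [k [jS kS jk]].
  have := size_of2_dsize jS kS jk.
  have := big_pairs j k; move: jS kS => /setD1P[_ ->] /setD1P[_ ->].
  move=> /(_ isT isT jk); move: fS; rewrite (dsizeD1 iS) /=; lia.
have [T [nT fT gT]] := fits_tip (Hbar0 p r) fr tm.
suff [i [iS iT le_i]] : exists i, [/\ i \in S, i \notin T &
    Num.min (Hw n / n%:R) ((Hw n - rho1 p) / n.-1%:R) <= val_of i].
  have := fw.1 (i |: T); rewrite gainU1 // dsizeU1 // cardsU1 iT nT gT.
  have -> : (size_of i + dsize T <= cap I w)%N.
    by apply: leq_trans (room i iS); rewrite leq_add2l.
  by move=> /(_ isT); apply: le_trans; rewrite lerD2r.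
have [disST|/pred0Pn[j /andP[/= jS jT]]] := boolP [disjoint S & T].
  have [|i iS] := @item_ge_mean I S; first by rewrite nS; lia.
  rewrite nS gS => le_i; exists i; split=> //; first by rewrite (disjointFr disST).
  by rewrite ge_min ler_pdivrMr 1?mulrC ?le_i // ltr0n; lia.
have nSj : #|S :\ j| = n.-1 by move: nS; rewrite (cardsD1 j) jS => <-.
have [|i] := @item_ge_mean I (S :\ j); first by rewrite nSj; lia.
rewrite nSj !inE => /andP[ij iS] le_i; exists i; split=> //.
  apply: contraTN (big_pairs i j iS jS ij) => iT.
  by rewrite -leqNgt (leq_trans _ fT) // size_of2_dsize.
have le_j : val_of j <= rho1 p.
  by rewrite rho1E; apply/(val_le_fits fr)/(leq_trans (size_of_dsize jT)).
rewrite ge_min orbC ler_pdivrMr ?ltr0n; last lia.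
rewrite [val_of i * _]mulrC (le_trans _ le_i) //.
by move: (gainD1 jS); rewrite gS; move: le_j; lra.
Qed.

End Necessity.

(** * Deciding whether a list of items fits *)

Local Close Scope ring_scope.
Local Open Scope nat_scope.

Definition height (hs : seq nat) (k : nat) : nat := sumn (take k hs).

Definition value_total (L : seq (nat * nat)) : nat := sumn (unzip1 L).
Definition size_total (L : seq (nat * nat)) : nat := sumn (unzip2 L).

(** Items are pairs of a value and a size.  [k] is the slack left by the items
    already taken: the amount by which their value falls short of the concave
    bound at their number.  [hs] lists the increments of that bound still to
    come, and [c] is the remaining capacity.  Every node of the search is a
    feasible set, so it is rejected as soon as the slack would become negative.
    Conditionals replace boolean connectives, here and below, so that
    call-by-value evaluation stops early. *)
Fixpoint bounded (hs : seq nat) (c k : nat) (L : seq (nat * nat)) : bool :=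
  if L is (v, d) :: L' then
    if d <= c then
      if v <= k + head 0 hs then
        if bounded (behead hs) (c - d) (k + head 0 hs - v) L'
        then bounded hs c k L' else false
      else false
    else bounded hs c k L'
  else true.

Fixpoint reaches (n c g : nat) (L : seq (nat * nat)) : bool :=
  match n, L with
  | 0, _ => g == 0
  | _.+1, [::] => false
  | n'.+1, (v, d) :: L' =>
      if (if d <= c then if v <= g then reaches n' (c - d) (g - v) L'
                         else false else false)
      then true else reaches n c g L'
  end.

Lemma height_behead (hs : seq nat) n :
  height hs n.+1 = head 0 hs + height (behead hs) n.
Proof. by case: hs => [|h hs]; rewrite /height. Qed.

Lemma bounded_mask hs c k L (m : bitseq) : bounded hs c k L ->
  size_total (mask m L) <= c ->
  value_total (mask m L) <= k + height hs (size (mask m L)).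
Proof.
elim: L hs c k m => [|[v d] L IHL] hs c k [|[] m] //=; rewrite ?mask0s //.
  case: leqP => [le_dc|gt_dc _]; last by rewrite /size_total /=; lia.
  case: leqP => // le_v; case: ifP => // bL _.
  rewrite /size_total /value_total /= => le_c.
  have {le_c} le_c : size_total (mask m L) <= c - d by rewrite /size_total; lia.
  have := IHL _ _ _ m bL le_c; rewrite height_behead /value_total; lia.
case: leqP => _; last exact: IHL.
by case: leqP => // _; case: ifP => // _; apply: IHL.
Qed.

Lemma reaches_mask n c g L : reaches n c g L -> exists m : bitseq,
  [/\ size m = size L, size (mask m L) = n, size_total (mask m L) <= c
    & value_total (mask m L) = g].
Proof.
elim: L n c g => [|[v d] L IHL] [|n] c g //=.
- by move/eqP->; exists [::].
- move/eqP->; exists (nseq (size L).+1 false).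
  by rewrite size_nseq mask_false.
case: ifP => [|_ /IHL[m [sm nm cm gm]]]; last first.
  by exists (false :: m); rewrite /= sm nm.
case: leqP => // le_dc; case: leqP => // le_vg /IHL[m [sm nm cm gm]] _.
exists (true :: m); rewrite /= sm nm /size_total /value_total /=.
by split=> //; move: cm gm; rewrite /size_total /value_total; lia.
Qed.

(** Values are counted in twelfths, so that a total can be shared equally among
    one, two, three or four items. *)
Definition unit_den : nat := 12.

Section ListInstance.
Variables (D R : nat) (L : seq (nat * nat)).
Hypothesis valid : (R < D) && all (fun it => 0 < it.2 <= D) L.
Local Notation it i := (tnth (in_tuple L) i).

Lemma valid_item i : 0 < (it i).2 <= D.
Proof. by case/andP: valid => _ /allP; apply; apply: mem_tnth. Qed.

Definition list_instance : instance.
Proof.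
refine (@Instance 'I_(size L) (fun i => (it i).1%:R / unit_den%:R)%R
          (fun i => (it i).2) R D _ _ _ _).
- by move=> i; rewrite divr_ge0 ?ler0n.
- by move=> i; case/andP: (valid_item i).
- by case/andP: valid.
- by move=> i; case/andP: (valid_item i).
Defined.

Definition mask_set (m : bitseq) : {set 'I_(size L)} :=
  [set i : 'I_(size L) | nth false m i].

Lemma mask_setE (S : {set 'I_(size L)}) :
  S = mask_set [seq i \in S | i <- enum 'I_(size L)].
Proof.
apply/setP=> i; rewrite inE (nth_map i) ?size_enum_ord //.
by rewrite nth_ord_enum.
Qed.

Lemma card_mask_set m : #|mask_set m| = size (mask m L).
Proof.
rewrite -sum1_card -[RHS]sum1_size big_mask; apply: eq_bigl => i.
by rewrite inE andbT.
Qed.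

Lemma dsize_mask_set m :
  @dsize list_instance (mask_set m) = size_total (mask m L).
Proof.
rewrite /size_total sumnE big_map big_mask; apply: eq_bigl => i.
by rewrite inE andbT.
Qed.

Lemma gain_mask_set m :
  @gain list_instance (mask_set m) = ((value_total (mask m L))%:R / unit_den%:R)%R.
Proof.
rewrite /value_total sumnE big_map big_mask natr_sum mulr_suml.
by apply: eq_bigl => i; rewrite inE andbT.
Qed.

End ListInstance.
Definition scaled (hs : seq nat) : seq nat := [seq unit_den * x | x <- hs].

(** Decides [fits] for the concave sequence with slopes [hs] and the items [L]
    under the capacity [c]. *)
Definition fits_list (hs : seq nat) (c : nat) (L : seq (nat * nat)) : bool :=
  if bounded (scaled hs) c 0 L then
    all (fun k => if nth 0 hs k.+1 < nth 0 hs k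
                  then reaches k.+1 c (unit_den * height hs k.+1) L else true)
        (iota 0 (size hs))
  else false.

Lemma height_scaled hs k : height (scaled hs) k = unit_den * height hs k.
Proof.
rewrite /height /scaled -map_take.
by elim: (take k hs) => //= x s ->; rewrite mulnDr.
Qed.

Lemma heightS hs k : height hs k.+1 = height hs k + nth 0 hs k.
Proof.
elim: hs k => [|h hs IHhs] [|k] //; first by rewrite /height /= take0 addn0.
by rewrite height_behead IHhs [height (h :: hs) _]height_behead addnA.
Qed.

Lemma list_instance_fits D R L valid s hs :
  fits_list hs (match s with w => D | r => R end) L ->
  fits (@list_instance D R L valid) s (fun k => (height hs k)%:R)%R.
Proof.
have den0 : (unit_den%:R : rat) != 0%R by [].
have den_gt0 : (0 < unit_den%:R :> rat)%R by [].
rewrite /fits_list; set c := match s with w => _ | r => _ end.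
have capE : cap (list_instance valid) s = c by rewrite /c; case: (s).
case: ifP => // bL /allP at_corner; split=> [S|[|k] //=].
  rewrite capE (mask_setE S) dsize_mask_set gain_mask_set card_mask_set.
  move/(bounded_mask bL); rewrite add0n height_scaled => le_v.
  by rewrite ler_pdivrMr // -natrM ler_nat mulnC.
rewrite /step !heightS !natrD => lt_k.
have {lt_k} lt_k : nth 0 hs k.+1 < nth 0 hs k.
  by rewrite -(ltr_nat rat); move: lt_k; rewrite !(addrC _ (nth _ _ _)%:R)%R !addrK.
have lt_size : k < size hs.
  by rewrite ltnNge; apply/negP => le_k; rewrite [nth 0 hs k]nth_default in lt_k.
have := at_corner k; rewrite mem_iota add0n lt_size lt_k => /(_ isT).
move/reaches_mask=> [m [sm nm cm gm]].
exists (mask_set L m); rewrite card_mask_set dsize_mask_set gain_mask_set capE.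
split=> //; rewrite gm natrM mulrC mulKf // heightS natrD.
by [].
Qed.

(** * Templates *)

(** Item values as functions of the target pair.  [mean s n] is [H_s(n) / n]
    when [n] is an s-vertex; [n] such items, each of size at most the [n]-th
    part of the capacity, attain [H_s(n)].
    [share s i t j k] is the [k]-th part of [H_s(i) - H_t(j)]: with [j] items
    that attain [H_t(j)], [k] such items complete the value to [H_s(i)]. *)
Inductive figure :=
  | mean of side & nat
  | share of side & nat & side & nat & nat.

Definition rise s n := share s n s n.-1 1.

Record template := Template {
  big_cap : nat;
  small_cap : nat;
  blueprint : seq (figure * nat)
}.

Section Blueprint.
Variables hs rs : seq nat.

Definition slopes (s : side) : seq nat := match s with w => hs | r => rs end.

Definition figure_value (x : figure) : nat :=
  match x with
  | mean s n =>
      if nth 0 (slopes s) n < nth 0 (slopes s) n.-1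
      then (unit_den * height (slopes s) n) %/ n else 0
  | share s i t j k =>
      (unit_den * (height (slopes s) i - height (slopes t) j)) %/ k
  end.

(** Items of value zero, which stand for slopes or vertices that the pair does
    not have, are left out. *)
Definition build (t : template) : seq (nat * nat) :=
  [seq it <- [seq (figure_value x.1, x.2) | x <- blueprint t] | 0 < it.1].

Definition suits (t : template) : bool :=
  let L := build t in
  if (small_cap t < big_cap t) && all (fun it => 0 < it.2 <= big_cap t) L then
    if fits_list hs (big_cap t) L then fits_list rs (small_cap t) L else false
  else false.

Fixpoint some_suits (ts : seq template) : bool :=
  if ts is t :: ts' then if suits t then true else some_suits ts' else false.

Definition LR_bound (n m : nat) : bool :=
  n.-1 * height hs n + n * height rs m <= n * height hs (n.-1 + m).

(** Six times the bound at [n = 3], the only vertex it concerns when [b_w = 3]. *)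
Definition PC_bound (m : nat) : bool :=
  6 * height rs m +
    minn (2 * height hs 3) (3 * (height hs 3 - nth 0 rs 0)) <= 6 * height hs m.+1.

Definition admissible : bool :=
  let ms := iota 0 (size rs).+1 in
  [&& all (fun m => height rs m <= height hs m) ms,
      all (fun n => if (nth 0 hs n < nth 0 hs n.-1) &&
                       (nth 0 rs 0 < nth 0 hs n.-1)
                    then all (LR_bound n) ms else true) [:: 1; 2; 3]
    & if height rs 2 + height hs 1 < height hs 3
      then all PC_bound ms else true].

End Blueprint.

(** The first three templates serve most pairs and show the patterns of the
    w-optimal sets.  In the first, the r-items, whose values are the slopes of
    [H_r], are completed by one item to [H_w(2)] or [H_w(3)].  In the second, the
    best r-item is completed to [H_w(3)] by two equal items; either of them next
    to r-items gives exactly the value in the second case of [PC_necessary].  In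
    the third, the w-optimal sets consist of [n] equal items of size [D / n],
    larger than [R]; exchanging one of them for r-items gives exactly the value
    in [LR_necessary]. *)
Definition templates : seq template :=
[::
   Template 12 7
     [:: (rise w 1, 12); (share w 2 r 1 1, 10); (share w 3 r 2 1, 8);
         (rise r 3, 4); (rise r 1, 2); (rise r 2, 1)];
   Template 12 4
     [:: (mean w 1, 12); (mean w 2, 6); (mean w 2, 6); (share w 3 r 1 2, 5);
         (share w 3 r 1 2, 5); (rise r 1, 2); (rise r 2, 1); (rise r 3, 1)];
   Template 24 7
     [:: (mean w 1, 24); (mean w 2, 12); (mean w 2, 12); (mean w 3, 8);
         (mean w 3, 8); (mean w 3, 8); (rise r 2, 3); (rise r 1, 2);
         (rise r 3, 1); (rise r 4, 1)];
   Template 24 7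
     [:: (mean w 1, 24); (mean w 2, 23); (share w 3 r 1 2, 14);
         (share w 3 r 1 2, 9); (rise r 1, 1); (rise r 2, 1); (rise r 3, 1);
         (rise r 4, 1)];
   Template 12 4
     [:: (mean w 1, 12); (share w 2 r 1 1, 10); (share w 3 r 1 2, 7);
         (share w 3 r 1 2, 4); (rise r 1, 1); (rise r 2, 1); (rise r 3, 1);
         (rise r 4, 1)];
   Template 12 6
     [:: (mean w 1, 12); (share w 3 r 2 1, 10); (rise r 1, 1); (rise r 2, 1);
         (rise r 3, 1); (rise r 4, 1)];
   Template 24 9
     [:: (rise w 2, 12); (rise w 1, 11); (rise r 1, 5); (rise r 2, 3);
         (rise r 3, 1)];
   Template 12 7
     [:: (rise w 1, 8); (rise r 1, 7); (rise r 3, 3); (rise w 2, 2);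
         (rise w 3, 2)];
   Template 12 7
     [:: (share w 2 r 1 1, 10); (rise r 2, 2); (rise r 3, 2); (rise r 1, 1);
         (rise r 4, 1)];
   Template 24 6
     [:: (mean w 2, 12); (mean w 2, 12); (share w 3 r 1 2, 11);
         (share w 3 r 1 2, 11); (rise r 1, 2); (rise r 2, 2); (rise r 3, 1)];
   Template 12 3
     [:: (rise w 1, 10); (share w 3 r 4 1, 7); (share r 4 r 1 1, 6);
         (mean w 2, 5); (rise r 1, 1); (rise r 3, 1); (rise r 2, 1)];
   Template 12 9
     [:: (rise w 1, 11); (share w 2 r 1 1, 10); (mean w 3, 8); (rise r 2, 6);
         (rise r 2, 4); (rise r 1, 2); (rise r 3, 2); (rise r 4, 1)];
   Template 12 10
     [:: (mean w 1, 10); (share r 3 r 1 2, 4); (rise r 4, 4); (rise w 3, 1);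
         (share w 2 r 1 1, 1)];
   Template 12 4
     [:: (rise w 1, 7); (share w 3 r 1 2, 6); (share w 3 r 1 2, 5);
         (rise r 1, 1); (rise r 2, 1); (rise r 3, 1)];
   Template 24 14
     [:: (rise w 1, 16); (mean r 1, 14); (mean r 3, 4); (mean r 3, 4);
         (mean r 3, 4)];
   Template 6 4
     [:: (rise r 1, 4); (share r 4 w 1 1, 3); (share w 1 w 0 2, 2);
         (rise w 3, 1); (rise w 2, 1)];
   Template 24 6
     [:: (mean w 1, 24); (mean w 2, 14); (mean w 2, 9); (rise r 1, 3);
         (rise r 2, 2); (rise r 3, 1)];
   Template 12 9
     [:: (rise w 1, 10); (share r 4 r 0 2, 9); (share w 3 r 3 3, 4);
         (rise r 4, 3); (rise w 3, 1); (share w 3 w 1 2, 1)];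
   Template 24 6
     [:: (rise w 1, 15); (rise w 2, 8); (mean r 2, 3); (mean r 2, 3);
         (mean r 3, 2); (mean r 3, 2); (mean r 3, 2); (mean r 4, 1);
         (rise w 3, 1)];
   Template 12 8
     [:: (mean r 1, 8); (share r 1 r 0 2, 2); (rise w 2, 2);
         (share w 2 r 1 1, 2); (share r 3 r 1 2, 2)];
   Template 24 6
     [:: (rise w 1, 16); (rise w 2, 7); (rise r 1, 3); (rise r 2, 1);
         (rise r 3, 1); (rise r 4, 1)];
   Template 12 4
     [:: (rise w 1, 7); (share r 4 r 0 2, 6); (rise w 2, 5); (mean r 1, 1);
         (share r 4 w 1 2, 1); (rise r 3, 1); (rise r 3, 1)];
   Template 24 19
     [:: (mean r 1, 19); (mean w 2, 12); (mean w 2, 12); (mean r 2, 9);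
         (mean r 2, 9); (mean w 3, 8); (mean w 3, 8); (mean w 3, 8);
         (mean r 3, 6); (mean r 3, 6); (mean r 3, 6)]].

Fixpoint nonincreasing_seqs (B k : nat) : seq (seq nat) :=
  if k is k'.+1
  then flatten [seq [seq x :: s | s <- nonincreasing_seqs x k'] | x <- iota 1 B]
  else [:: [::]].

Definition all_realized (B M : nat) : bool :=
  all (fun hs => all (fun k => all (fun rs =>
      if admissible hs rs then some_suits hs rs templates else true)
    (nonincreasing_seqs B k)) (iota 0 M.+1)) (nonincreasing_seqs B 3).

Lemma all_realized_6_3 : all_realized 6 3.
Proof. by vm_compute. Qed.

Lemma all_realized_4_4 : all_realized 4 4.
Proof. by vm_compute. Qed.

(** * From the target pair to integer slopes *)

Lemma mem_nonincreasing_seqs B hs :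
  path geq B hs -> all (ltn 0) hs -> hs \in nonincreasing_seqs B (size hs).
Proof.
elim: hs B => [|x s IHs] B //= /andP[le_xB ps] /andP[x0 s0].
apply/flatten_mapP; exists x; first by rewrite mem_iota x0 add1n ltnS.
by rewrite map_f ?IHs.
Qed.

Lemma Hbar_height p s (hs : seq nat) :
  (forall k, step (Hbar p s) k = (nth 0 hs k)%:R)%R ->
  forall k, Hbar p s k = ((height hs k)%:R)%R.
Proof.
move=> step_hs; elim=> [|k IHk]; first by rewrite Hbar0 /height take0.
by rewrite heightS natrD -IHk -step_hs /step addrC subrK.
Qed.

Lemma integral_slopes p s B :
  (forall n, 0 < n <= b p s ->
     exists2 k : nat, 0 < k <= B & (slope (H p s) n = k%:R)%R) ->
  exists hs, [/\ size hs = b p s, hs \in nonincreasing_seqs B (b p s)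
    & forall k, (step (Hbar p s) k = (nth 0 hs k)%:R)%R].
Proof.
move=> int_slope.
pose hs := mkseq (fun k => Num.truncn (step (Hbar p s) k)) (b p s).
have step_hs k : (step (Hbar p s) k = (nth 0 hs k)%:R)%R.
  case: (ltnP k (b p s)) => [lt_kb|le_bk]; last first.
    by rewrite step_Hbar0 // nth_default ?size_mkseq.
  rewrite nth_mkseq // step_Hbar //.
  by have [|n _ ->] := int_slope k.+1; rewrite ?natrK.
have bound k : k < size hs -> 0 < nth 0 hs k <= B.
  rewrite size_mkseq => lt_kb.
  have [|n n_bound] := int_slope k.+1; first by [].
  by rewrite -step_Hbar // step_hs => /eqP; rewrite eqr_nat => /eqP->.
exists hs; split=> //; first by rewrite size_mkseq.
rewrite -[b p s](size_mkseq (fun k => Num.truncn (step (Hbar p s) k))).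
apply: mem_nonincreasing_seqs.
  apply/(pathP 0) => -[|k] lt_k /=; first by case/andP: (bound 0 lt_k).
  by rewrite -(ler_nat rat) -!step_hs; apply: Hbar_concave.
by apply/(all_nthP 0) => k /bound /andP[].
Qed.

Section Sufficiency.
Variables (p : target_pair) (hs rs : seq nat).
Hypothesis size_hs : size hs = b p w.
Hypothesis size_rs : size rs = b p r.
Hypothesis step_hs : forall k, (step (Hbar p w) k = (nth 0 hs k)%:R)%R.
Hypothesis step_rs : forall k, (step (Hbar p r) k = (nth 0 rs k)%:R)%R.

Let HwE := Hbar_height step_hs.
Let HrE := Hbar_height step_rs.

Let HrE_le m : m <= b p r -> ((H p r)`_m = (height rs m)%:R)%R.
Proof. by move=> le_mb; rewrite -HrE Hbar_le. Qed.

Let HwE_le n : n <= b p w -> ((H p w)`_n = (height hs n)%:R)%R.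
Proof. by move=> le_nb; rewrite -HwE Hbar_le. Qed.

Let rho1_nth : (rho1 p = (nth 0 rs 0)%:R)%R.
Proof. by rewrite rho1E -step_rs /step Hbar0 subr0. Qed.

Lemma conditions_admissible : b p w = 3 -> dominance p ->
  (forall m, m <= b p r -> LR p m /\ PC p m) -> admissible hs rs.
Proof.
move=> bw dom conds.
have in_ms m : m \in iota 0 (size rs).+1 -> m <= b p r.
  by rewrite mem_iota add0n ltnS size_rs.
have dom_nat m : m <= b p r -> height rs m <= height hs m.
  by move=> le_mb; rewrite -(ler_nat rat) -HwE -HrE_le // dom.
apply/and3P; split.
- by apply/allP => m /in_ms /dom_nat.
- apply/allP => n n123.
  have n_bw : 0 < n <= b p w by move: n123; rewrite bw !inE => /or3P[] /eqP->.
  case: ifP => // /andP[corner_n lt_rho]; apply/allP => m /in_ms le_mb.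
  have vn : vertex p w n.
    rewrite vertexE; case: n n_bw corner_n {n123 lt_rho} => // n _.
    by rewrite /= !step_hs ltr_nat.
  have lt_rho' : (rho1 p < slope (H p w) n)%R.
    case: n n_bw lt_rho {n123 corner_n vn} => // n n_bw.
    by rewrite -step_Hbar // step_hs rho1_nth ltr_nat.
  have := (conds m le_mb).1 n vn lt_rho'.
  case/andP: n_bw => n0 le_nb.
  rewrite /LR_ineq /LR_bound HrE_le // HwE_le // HwE -(ler_nat rat) natrD !natrM.
  have nR0 : (0 < n%:R :> rat)%R by rewrite ltr0n.
  rewrite -(ler_pM2l nR0) mulrDr mulrA [(n%:R * (_ / _))%R]mulrC divfK //.
  by rewrite gt_eqF.
- case: ifP => // lt_pair; apply/allP => m /in_ms le_mb.
  have v3 : vertex p w 3.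
    by apply/andP; split; [rewrite bw | apply/orP; left; rewrite bw].
  have lt_pair' : (Hbar p r 2 < (H p w)`_3 - (3.-2)%:R * (H p w)`_1)%R.
    by rewrite !HwE_le ?bw // HrE mul1r ltrBrDr -natrD ltr_nat.
  have := (conds m le_mb).2 3 v3 isT lt_pair'.
  rewrite /PC_bound !HwE_le ?bw // HrE_le // rho1_nth HwE.
  have le_rho : nth 0 rs 0 <= height hs 3.
    have le1 : height rs 1 <= height hs 1.
      case: (leqP 1 (b p r)) => [/dom_nat //|]; rewrite ltnS leqn0 -size_rs.
      by move/eqP/size0nil->.
    have -> : nth 0 rs 0 = height rs 1 by rewrite heightS /height take0.
    apply: leq_trans le1 _.
    by rewrite [height hs 3]heightS [height hs 2]heightS; lia.
  rewrite minEle; case: ifP => _ le_r.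
    suff : 6 * height rs m + 2 * height hs 3 <= 6 * height hs m.+1 by lia.
    rewrite -(ler_nat rat) natrD !natrM; move: le_r => /=; lra.
  suff : 6 * height rs m + 3 * height hs 3 <=
         6 * height hs m.+1 + 3 * nth 0 rs 0 by lia.
  rewrite -(ler_nat rat) (natrD _ (6 * _)) (natrD _ (6 * _) (3 * nth 0 rs 0)).
  by rewrite !natrM; move: le_r => /=; lra.
Qed.

Lemma suits_realizable t : suits hs rs t -> realizable p.
Proof.
rewrite /suits; case: ifP => // valid; case: ifP => // fit_w fit_r.
apply/realizableP; exists (list_instance valid).
have ext I s f g : f =1 g -> fits I s f -> fits I s g.
  move=> fg [ub at_corner]; split=> [S /ub|n]; first by rewrite fg.
  have -> : corner g n = corner f n by case: n => // n; rewrite /= /step !fg.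
  by rewrite -fg; apply: at_corner.
case.
- by apply: ext (@list_instance_fits _ _ _ valid w hs fit_w) => k; rewrite HwE.
- by apply: ext (@list_instance_fits _ _ _ valid r rs fit_r) => k; rewrite HrE.
Qed.

Lemma some_suits_realizable ts : some_suits hs rs ts -> realizable p.
Proof. by elim: ts => //= t ts IHts; case: ifP => // /suits_realizable. Qed.

End Sufficiency.

Lemma domain_realizable B M p : all_realized B M -> domP B M p ->
  (forall m, m <= b p r -> LR p m /\ PC p m) -> realizable p.
Proof.
move=> /allP real [bw le_bM int_slope dom] conds.
have [hs [size_hs mem_hs step_hs]] := integral_slopes (int_slope w).
have [rs [size_rs mem_rs step_rs]] := integral_slopes (int_slope r).
move: mem_hs; rewrite bw => /real /allP /(_ (b p r)).
rewrite mem_iota add0n ltnS le_bM => /(_ isT) /allP /(_ rs mem_rs).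
rewrite (conditions_admissible size_hs size_rs step_hs step_rs) //.
exact: some_suits_realizable.
Qed.

Lemma domP_mono B B' M M' p : B <= B' -> M <= M' -> domP B M p -> domP B' M' p.
Proof.
move=> leB leM [bw le_bM int_slope dom]; split=> //; first exact: leq_trans leM.
move=> s n /int_slope[k /andP[k0 le_kB] Ek]; exists k => //.
by rewrite k0 (leq_trans le_kB).
Qed.

Theorem propositionB2 (p : target_pair)
    (dom_p : domP 5 3 p \/ domP 6 3 p \/ domP 4 4 p \/
             domPf 5 3 p \/ domPf 6 3 p \/ domPf 4 4 p) :
  realizable p <->
  dominance p /\ forall m : nat, (m <= b p r)%N -> LR p m /\ PC p m.
Proof.
have {dom_p} dom_p : domP 6 3 p \/ domP 4 4 p.
  case: dom_p => [d53|[d63|[d44|[[d53 _ _ _]|[[d63 _ _ _]|[d44 _ _ _]]]]]].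
  - by left; apply: domP_mono d53.
  - by left.
  - by right.
  - by left; apply: domP_mono d53.
  - by left.
  - by right.
split=> [/realizableP[I fits_I]|[_ conds]]; last first.
  by case: dom_p => d; [apply: domain_realizable all_realized_6_3 d conds
                       |apply: domain_realizable all_realized_4_4 d conds].
split=> [|m le_mb]; first by case: dom_p => -[].
split=> n vn.
- have /andP[/andP[n0 le_nb] _] := vn; move: vn; rewrite vertexE => cn lt_rho.
  have := @LR_necessary p I (fits_I w) (fits_I r) n m cn.
  rewrite /LR_ineq -!Hbar_le // => -> //.
  by case: n n0 le_nb {cn} lt_rho => // n _ lt_nb; rewrite -step_Hbar.
- have /andP[/andP[n0 le_nb] _] := vn; move: vn; rewrite vertexE => cn n3.
  have le_1b : (1 <= b p w)%N by apply: leq_trans le_nb; apply: leq_trans n3.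
  rewrite -!Hbar_le // => lt_pair.
  exact: (PC_necessary (fits_I w) (fits_I r)).
Qed.
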